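(* Let $(Q,\cdot)$ be a quasigroup of finite order $n$ with associated latin square $L$. The following conditions are equivalent: (1) $L$ has $n^2(n-1)/18$ subsquares of order $3$. (2) For any two (distinct) occurrences of the same symbol in $L$, there is a subsquare of $L$ of order $3$ containing those two occurrences. (3) Every cell in $L$ is in $(n-1)/2$ subsquares of order $3$. (4) Every loop isotopic to $Q$ has exponent $3$. (5) For any distinct $x,y\in Q$, $L_x^{-1}L_y$ and $R_x^{-1}R_y$ are regular permutations of order $3$. (6) In any loop isotope $(Q,\circ)$ of $Q$ and for each nonidentity element $x$ of $(Q,\circ)$, the translations $L_x^{\circ}$ and $R_x^{\circ}$ of $(Q,\circ)$ are regular permutations of order $3$. (7) In any loop isotopic to $Q$, there are $(n-1)/2$ subloops of order $3$.
   Context: A quasigroup is a set $Q$ with a binary operation such that all left translations $L_x(y)=xy$ and right translations $R_x(y)=yx$ are bijections of $Q$; a loop is a quasigroup with a two-sided neutral element $\varepsilon$. The latin square $L$ associated with $Q$ is its Cayley table: rows and columns are indexed by $Q$ and the cell $(x,y)$ contains the symbol $xy$. A subsquare of order $k$ of a latin square is a $k\times k$ submatrix (given by a set of $k$ rows and a set of $k$ columns, not necessarily contiguous) that is itself a latin square (i.e. contains exactly $k$ distinct symbols). Quasigroups $(Q,\cdot)$ and $(P,\circ)$ are isotopic if there are bijections $\alpha,\beta,\gamma:Q\to P$ with $\alpha(x)\circ\beta(y)=\gamma(x\cdot y)$ for all $x,y$. For $a,b\in Q$, the loop isotope $Q_{a,b}=(Q,\circ)$ is defined by $x\circ y=R_a^{-1}(x)\cdot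 L_b^{-1}(y)$ and has neutral element $ba$; every loop isotopic to $Q$ is isomorphic to one of this form. In a loop isotope $(Q,\circ)$, the translations are denoted $L_x^{\circ}(y)=x\circ y$ and $R_x^{\circ}(y)=y\circ x$; ''nonidentity'' means different from the neutral element of $(Q,\circ)$. A loop has exponent $3$ if it satisfies $xx\cdot x=x\cdot xx=\varepsilon$ for all $x$. A permutation is regular of order $3$ if all of its cycles have length $3$ (in particular it has no fixed points). In conditions (1), (3) and (7) the stated numbers are exact counts. *)

(* Defs.v *)
From mathcomp Require Import all_boot all_order all_fingroup all_algebra.

Set Implicit Arguments.
Unset Strict Implicit.
Unset Printing Implicit Defensive.

Local Open Scope group_scope.

(* The operation is a field rather than a canonical structure on the carrier,
   because one set [Q] carries many operations here (its loop isotopes). *)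
Record quasigroup (Q : finType) := Quasigroup {
  qmul :> Q -> Q -> Q;
  qmul_bijl : forall x, bijective (qmul x);
  qmul_bijr : forall x, bijective (qmul^~ x)
}.

Record loop (Q : finType) := Loop {
  loop_quasigroup :> quasigroup Q;
  neutral : Q;
  neutral_left : left_id neutral loop_quasigroup;
  neutral_right : right_id neutral loop_quasigroup
}.

Definition ltrans (Q : finType) (q : quasigroup Q) (x : Q) : {perm Q} :=
  perm (bij_inj (qmul_bijl q x)).

Definition rtrans (Q : finType) (q : quasigroup Q) (x : Q) : {perm Q} :=
  perm (bij_inj (qmul_bijr q x)).

Definition isotopic (Q P : finType) (q : quasigroup Q) (p : quasigroup P) :
    Prop :=
  exists alpha beta gamma : Q -> P,
    [/\ bijective alpha, bijective beta, bijective gamma &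
        forall x y, p (alpha x) (beta y) = gamma (q x y)].

Section LoopIsotope.
Variables (Q : finType) (q : quasigroup Q) (a b : Q).

Definition isotope_mul (x y : Q) : Q :=
  q ((rtrans q a)^-1 x) ((ltrans q b)^-1 y).

Lemma isotope_mul_bijl x : bijective (isotope_mul x).
Proof.
apply: (bij_comp (qmul_bijl q ((rtrans q a)^-1 x))).
by exists (ltrans q b); [apply: permKV | apply: permK].
Qed.

Lemma isotope_mul_bijr y : bijective (isotope_mul^~ y).
Proof.
apply: (bij_comp (qmul_bijr q ((ltrans q b)^-1 y))).
by exists (rtrans q a); [apply: permKV | apply: permK].
Qed.

Definition isotope_quasigroup := Quasigroup isotope_mul_bijl isotope_mul_bijr.

Lemma isotope_neutral_left : left_id (q b a) isotope_quasigroup.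
Proof.
move=> y; rewrite /= /isotope_mul.
have -> : q b a = rtrans q a b by rewrite permE.
by rewrite permK -[q b _](permE (bij_inj (qmul_bijl q b))) permKV.
Qed.

Lemma isotope_neutral_right : right_id (q b a) isotope_quasigroup.
Proof.
move=> x; rewrite /= /isotope_mul.
have -> : q b a = ltrans q b a by rewrite permE.
by rewrite permK -[q _ a](permE (bij_inj (qmul_bijr q a))) permKV.
Qed.

Definition loop_isotope : loop Q :=
  Loop isotope_neutral_left isotope_neutral_right.

End LoopIsotope.

(* A subsquare is given by its set of rows and its set of columns. *)
Definition subsquares (Q : finType) (q : quasigroup Q) (k : nat) :
    {set {set Q} * {set Q}} :=
  [set S : {set Q} * {set Q} |
    [&& #|S.1| == k, #|S.2| == k & #|q @2: (S.1, S.2)| == k]].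

Definition in_subsquare (Q : finType) (x y : Q) (S : {set Q} * {set Q}) : bool :=
  (x \in S.1) && (y \in S.2).

Definition exponent3 (Q : finType) (l : loop Q) : Prop :=
  forall x, l (l x x) x = neutral l /\ l x (l x x) = neutral l.

Definition regular3 (Q : finType) (s : {perm Q}) : Prop :=
  forall C, C \in porbits s -> #|C| = 3.

(* The inverse translations are the left and right divisions of the loop. *)
Definition is_subloop (Q : finType) (l : loop Q) (S : {set Q}) : bool :=
  (neutral l \in S) &&
  [forall x in S, forall y in S,
    [&& l x y \in S, (ltrans l x)^-1 y \in S & (rtrans l x)^-1 y \in S]].

Definition subloops (Q : finType) (l : loop Q) (k : nat) : {set {set Q}} :=
  [set S | is_subloop l S & #|S| == k].

(* Main.v *)
(* Every condition says that each cell [(x, y)] is completable: any other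
   occurrence [(x', y')] of its symbol lies with it in a subsquare of order 3,
   whose third row and column are then forced. Hence a subsquare through
   [(x, y)] is determined by any of its two other rows, so there are at most
   (n - 1) / 2 of them, with equality iff the cell is completable; summing
   over the n^2 cells, nine of which lie in each subsquare, bounds the number
   of subsquares, again with equality iff all cells are completable.
   Completability is invariant under isotopy, and in a loop the subsquares
   through the cell (e, e) are the squares S x S of subloops, so that
   completability there means exponent 3. If [x w = y z], the subsquare through
   [(x, w)] and [(y, z)] exhibits the 3-cycle of L_x^-1 L_y containing [z];
   the translations of loop isotopes are conjugate to such permutations, and
   their cubes being trivial gives back exponent 3. *)
Require Import Defs.
From mathcomp Require Import all_boot all_order all_fingroup all_algebra.
From mathcomp Require Import zify ring lra.

Set Implicit Arguments.
Unset Strict Implicit.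
Unset Printing Implicit Defensive.

Import GRing.Theory Num.Theory.

(** * Subsquares of order 3 through a cell *)

Section Quasigroup.
Variables (Q : finType) (q : quasigroup Q).

Lemma qmulI x : injective (q x).
Proof. exact: bij_inj (qmul_bijl q x). Qed.

Lemma qmulIr y : injective (q^~ y).
Proof. exact: bij_inj (qmul_bijr q y). Qed.

Lemma ltransE x y : ltrans q x y = q x y.
Proof. by rewrite permE. Qed.

Lemma rtransE x y : rtrans q x y = q y x.
Proof. by rewrite permE. Qed.

Lemma ltransKV x y : q x ((ltrans q x)^-1 y)%g = y.
Proof. by rewrite -ltransE permKV. Qed.

Lemma rtransKV x y : q ((rtrans q x)^-1 y)%g x = y.
Proof. by rewrite -[LHS]rtransE permKV. Qed.

(* Rows [x, x', x''] against columns [y, y', y''], with [q x y = q x' y'] on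
   the diagonal, form a circulant latin square. *)
Definition square3 x y x' y' x'' y'' : Prop :=
  [/\ q x y'' = q x' y, q x' y'' = q x y', q x'' y = q x y',
      q x'' y' = q x' y & q x'' y'' = q x y].

Definition completable x y : Prop :=
  forall x' y', x' != x -> q x' y' = q x y ->
  exists x'' y'', square3 x y x' y' x'' y''.

Definition cell_subsquares x y :=
  [set S in subsquares q 3 | in_subsquare x y S].

Lemma subsquareP (S : {set Q} * {set Q}) : reflect
  [/\ #|S.1| = 3, #|S.2| = 3 & #|q @2: (S.1, S.2)| = 3] (S \in subsquares q 3).
Proof.
rewrite inE; apply: (iffP and3P) => [[/eqP-> /eqP-> /eqP->] | [-> -> ->]] //.
Qed.

Lemma card3D1 (T : finType) (A : {set T}) x x' : #|A| = 3 -> x \in A ->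
  x' \in A -> x' != x -> exists2 x'', A = [set x; x'; x''] &
  (x'' != x) && (x'' != x').
Proof.
move=> A3 xA x'A nxx'; have /cards1P[x'' Ax''] : #|A :\ x :\ x'| == 1.
  by move: A3; rewrite (cardsD1 x) xA (cardsD1 x') !inE nxx' x'A => -[/eqP].
have: x'' \in A :\ x :\ x' by rewrite Ax'' set11.
rewrite !inE => /and3P[n1 n2 _]; exists x''; last by rewrite n1 n2.
by rewrite -(setD1K xA) -(setD1K (_ : x' \in A :\ x)) ?inE ?nxx' // Ax'' setUA.
Qed.

(** Three rows of three distinct symbols each, drawn from only three symbols, all carry the same
    symbols. Once one symbol is placed at [(x, y)] and [(x', y')], the other entries follow by
    exclusion along rows and columns. *)
Lemma subsquare_square3 S x y x' : S \in cell_subsquares x y ->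
  x' \in S.1 -> x' != x -> exists y' x'' y'',
  [/\ q x' y' = q x y, square3 x y x' y' x'' y'',
      S.1 = [set x; x'; x''] & S.2 = [set y; y'; y'']].
Proof.
rewrite inE => /andP[/subsquareP[A3 B3 C3] /andP[xA yB]] x'A nxx'.
have rowE r : r \in S.1 -> q r @: S.2 = q @2: (S.1, S.2).
  move=> rA; apply/eqP; rewrite eqEcard card_imset ?C3 ?B3 ?andbT;
    last exact: qmulI.
  by apply/subsetP=> _ /imsetP[c cB ->]; apply: imset2_f.
have /imsetP[y' y'B exy]: q x y \in q x' @: S.2.
  by rewrite rowE // imset2_f.
have nyy': y' != y.
  by apply/eqP=> e; move: exy nxx'; rewrite e => /(@qmulIr y)->; rewrite eqxx.
have [y'' BE /andP[ny1 ny2]] := card3D1 B3 yB y'B nyy'.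
have [x'' AE /andP[nx1 nx2]] := card3D1 A3 xA x'A nxx'.
have mem r c : r \in S.1 -> c \in S.2 ->
    [|| q r c == q x y, q r c == q x y' | q r c == q x y''].
  move=> rA cB; have: q r c \in q x @: S.2 by rewrite rowE // imset2_f.
  by rewrite BE !imsetU !imset_set1 !inE -orbA.
have neqc r c c' : q r c = q r c' -> c' != c -> False.
  by move/(@qmulI r)=> ->; rewrite eqxx.
have neqr r r' c : q r c = q r' c -> r' != r -> False.
  by move/(@qmulIr c)=> ->; rewrite eqxx.
have y''B : y'' \in S.2 by rewrite BE !inE eqxx !orbT.
have x''A : x'' \in S.1 by rewrite AE !inE eqxx !orbT.
(* If [q x' y] were [q x y'], no symbol would be left for [(x', y'')]: two already occur in row
   [x'], the third in column [y'']. *)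
have e1 : q x y'' = q x' y.
  case/or3P: (mem x' y x'A yB) => /eqP e; rewrite ?e //.
    by case: (neqr _ _ _ (esym e)).
  case/or3P: (mem x' y'' x'A y''B) => /eqP e'.
  - by case: (neqc x' y' y''); rewrite // -exy.
  - by case: (neqc x' y y''); rewrite // e e'.
  - by case: (neqr _ _ _ (esym e')).
have e2 : q x' y'' = q x y'.
  case/or3P: (mem x' y'' x'A y''B) => /eqP // e.
  - by case: (neqc x' y' y''); rewrite // -exy.
  - by case: (neqr _ _ _ (esym e)).
have e3 : q x'' y = q x y'.
  case/or3P: (mem x'' y x''A yB) => /eqP // e.
  - by case: (neqr _ _ _ (esym e)).
  - by case: (neqr x' x'' y); rewrite // e.
have e4 : q x'' y' = q x' y.
  case/or3P: (mem x'' y' x''A y'B) => /eqP e; last by rewrite e.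
  - by case: (neqr x' x'' y'); rewrite // e.
  - by case: (neqr _ _ _ (esym e)).
exists y', x'', y''; split=> //; split=> //.
case/or3P: (mem x'' y'' x''A y''B) => /eqP // e.
- by case: (neqr x' x'' y''); rewrite // e.
- by case: (neqr _ _ _ (esym e)).
Qed.

Lemma square3_subsquare x y x' y' x'' y'' : x' != x -> q x' y' = q x y ->
  square3 x y x' y' x'' y'' ->
  ([set x; x'; x''], [set y; y'; y'']) \in subsquares q 3.
Proof.
move=> nxx' exy [e1 e2 e3 e4 e5].
have nyy' : y' != y.
  by apply: contraNneq nxx' => e; rewrite -e in exy; rewrite (qmulIr exy).
have nx1 : x'' != x.
  by apply: contraNneq nyy' => e; rewrite e in e3; rewrite (qmulI e3).
have nx2 : x'' != x'.
  by apply: contraNneq nyy' => e; rewrite e in e4; rewrite (qmulI e4).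
have ny1 : y'' != y.
  by apply: contraNneq nxx' => e; rewrite e in e1; rewrite (qmulIr e1).
have ny2 : y'' != y'.
  by apply: contraNneq nxx' => e; rewrite e in e2; rewrite (qmulIr e2).
have B3 : #|[set y; y'; y'']| = 3.
  by rewrite -setUA !cardsU1 cards1 !inE negb_or [y == _]eq_sym nyy'
    eq_sym ny1 eq_sym ny2.
apply/subsquareP; split=> //=.
  by rewrite -setUA !cardsU1 cards1 !inE negb_or [x == _]eq_sym nxx'
    eq_sym nx1 eq_sym nx2.
(* The symbols of the square are exactly those of its row [x], which are distinct by
   cancellation. *)
rewrite -B3 -[RHS](card_imset _ (@qmulI x)).
apply/eq_card/subset_eqP/andP; split.
  apply/subsetP=> _ /imset2P[r c /= + + ->]; rewrite !inE -!orbA => rA cB.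
  rewrite !imsetU !imset_set1 !inE.
  case/or3P: rA => /eqP->; case/or3P: cB => /eqP->;
    by rewrite ?exy ?e5 ?e4 ?e3 ?e2 -?e1 eqxx ?orbT.
apply/subsetP=> _ /imsetP[c cB ->]; apply: imset2_f => //=.
by rewrite !inE eqxx.
Qed.

(** This is condition (2) at a single cell. Two distinct occurrences of a symbol cannot share a row,
    so assuming [x' != x] loses nothing. *)
Lemma completableP x y : completable x y <->
  forall x' y', (x, y) <> (x', y') -> q x y = q x' y' ->
  exists S, [/\ S \in subsquares q 3, in_subsquare x y S & in_subsquare x' y' S].
Proof.
split=> [cxy x' y' nxy exy | sxy x' y' nxx' exy].
  have nxx' : x' != x.
    apply/eqP=> e; apply: nxy; rewrite e in exy *.
    by rewrite (qmulI exy).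
  have [x'' [y'' sq]] := cxy x' y' nxx' (esym exy).
  exists ([set x; x'; x''], [set y; y'; y'']); split.
  - exact: square3_subsquare sq.
  - by rewrite /in_subsquare !inE !eqxx.
  - by rewrite /in_subsquare !inE !eqxx !orbT.
have nxy : (x, y) <> (x', y') by case=> e _; rewrite e eqxx in nxx'.
have [S [SS xyS /andP[x'S _]]] := sxy x' y' nxy (esym exy).
have Sc : S \in cell_subsquares x y by rewrite inE SS.
have [z [x'' [y'' [exz sq _ _]]]] := subsquare_square3 Sc x'S nxx'.
exists x'', y''; suff -> : y' = z by [].
by apply: (@qmulI x'); rewrite exz.
Qed.

(** * Counting subsquares, first through a cell and then in the whole square *)

Lemma cell_subsquare_uniq x y x' S S' : x' != x ->
  S \in cell_subsquares x y -> S' \in cell_subsquares x y ->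
  x' \in S.1 -> x' \in S'.1 -> S = S'.
Proof.
move=> nxx' Sc S'c x'S x'S'.
have [z [x1 [y1 [ez [e1 _ e2 _ _] A B]]]] := subsquare_square3 Sc x'S nxx'.
have [z' [x2 [y2 [ez' [e1' _ e2' _ _] A' B']]]] := subsquare_square3 S'c x'S' nxx'.
(* Everything is forced in turn: the second column by the symbol [q x y] in row [x'], the third
   column by [q x' y] in row [x], the third row by the second symbol of row [x] in column [y]. *)
have ezz : z' = z by apply: (@qmulI x'); rewrite ez.
have eyy : y2 = y1 by apply: (@qmulI x); rewrite e1.
have exx : x2 = x1 by apply: (@qmulIr y); rewrite e2 -ezz.
by case: S S' A B A' B' {Sc S'c x'S x'S'} => [? ?] [? ?] /= -> -> -> ->;
  rewrite ezz eyy exx.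
Qed.

(** Double count the pairs of a subsquare through [(x, y)] and a row of it other than [x]: each
    subsquare has two such rows, and each row occurs at most once. The form [.*2.+1] avoids halving
    [n - 1]. *)
Lemma cell_subsquares_leqif x y :
  #|cell_subsquares x y|.*2.+1 <= #|Q| ?= iff
  [forall x' in predC1 x, exists S in cell_subsquares x y, x' \in S.1].
Proof.
set D := cell_subsquares x y.
have E : #|D|.*2 = \sum_(x' | x' != x) #|[set S in D | x' \in S.1]|.
  have -> : #|D|.*2 = \sum_(S in D) \sum_(x' | x' != x) (x' \in S.1).
    rewrite -muln2 -sum_nat_const; apply: eq_bigr => S.
    rewrite inE => /andP[/subsquareP[A3 _ _] /andP[xA _]].
    move: A3; rewrite (cardsD1 x) xA => -[<-].
    rewrite -sum1_card big_mkcond [RHS]big_mkcond.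
    by apply: eq_bigr => z _; rewrite !inE; case: (z != x); case: (z \in _).
  rewrite exchange_big; apply: eq_bigr => x' _.
  rewrite -sum1_card big_mkcond [RHS]big_mkcond.
  by apply: eq_bigr => S _; rewrite [in RHS]inE; case: (S \in D); case: (x' \in _).
rewrite (cardD1 x) inE add1n E -sum1_card.
have -> : \sum_(i in [predD1 Q & x]) 1 = \sum_(i | i != x) 1.
  by apply: eq_bigl => i; rewrite !inE andbT.
have le1 x' : x' != x -> #|[set S in D | x' \in S.1]| <= 1
    ?= iff [exists S in D, x' \in S.1].
  move=> nx; set F := [set S in D | x' \in S.1].
  have -> : [exists S in D, x' \in S.1] = (0 < #|F|).
    apply/existsP/card_gt0P => -[S SF]; exists S; move: SF;
      by rewrite [S \in F]inE.
  suff: #|F| <= 1 by case: #|F| => [|[]].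
  apply/card_le1_eqP => S S'; rewrite [S \in F]inE [S' \in F]inE.
  move=> /andP[SD xS] /andP[S'D xS'].
  exact: (cell_subsquare_uniq nx S'D SD xS' xS).
have [le_sum eq_sum] := leqif_sum le1.
by split; rewrite // eqSS eq_sum; apply: eq_forallb => z; rewrite !inE.
Qed.

Lemma card_cell_subsquares_le x y : #|cell_subsquares x y|.*2.+1 <= #|Q|.
Proof. exact: cell_subsquares_leqif. Qed.

Lemma card_cell_subsquares x y :
  #|cell_subsquares x y|.*2.+1 = #|Q| <-> completable x y.
Proof.
have [_ eqQ] := cell_subsquares_leqif x y.
split=> [/eqP|cxy]; [|apply/eqP]; rewrite eqQ.
  move=> /forall_inP sxy x' y' nxx' exy.
  have /exists_inP[S SD x'S] := sxy x' nxx'.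
  have [z [x'' [y'' [exz sq _ _]]]] := subsquare_square3 SD x'S nxx'.
  exists x'', y''; suff -> : y' = z by [].
  by apply: (@qmulI x'); rewrite exz.
apply/forall_inP=> x'; rewrite inE => nxx'; apply/exists_inP.
(* The column where row [x'] carries the symbol of [(x, y)]. *)
pose y' := ((ltrans q x')^-1 (q x y))%g.
have exy : q x' y' = q x y by rewrite ltransKV.
have [x'' [y'' sq]] := cxy x' y' nxx' exy.
exists ([set x; x'; x''], [set y; y'; y'']); last by rewrite !inE eqxx orbT.
by rewrite inE (square3_subsquare nxx' exy sq) /in_subsquare !inE !eqxx.
Qed.

Lemma sum_cell_subsquares :
  \sum_(c : Q * Q) #|cell_subsquares c.1 c.2| = 9 * #|subsquares q 3|.
Proof.
transitivity (\sum_(S in subsquares q 3)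
    \sum_(c : Q * Q) in_subsquare c.1 c.2 S).
  rewrite exchange_big; apply: eq_bigr => c _.
  rewrite -sum1_card big_mkcond [RHS]big_mkcond.
  apply: eq_bigr => S _; rewrite [in LHS]inE.
  by case: (S \in subsquares q 3); case: (in_subsquare _ _ _).
rewrite mulnC -sum_nat_const; apply: eq_bigr => S /subsquareP[A3 B3 _].
rewrite -big_mkcond /= sum1_card -[9]/(3 * 3) -{1}A3 -B3 -cardsX.
by apply: eq_card => c; rewrite !inE.
Qed.

(** Condition (1) cleared of division and subtraction. It is the sum of the cell bounds over all
    [n ^ 2] cells, and equality of the sums forces equality in every term. *)
Lemma card_subsquares :
  18 * #|subsquares q 3| + #|Q| ^ 2 = #|Q| ^ 3 <->
  forall x y, completable x y.
Proof.
have le_cell (c : Q * Q) : true -> #|cell_subsquares c.1 c.2|.*2.+1 <= #|Q|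
    ?= iff (#|cell_subsquares c.1 c.2|.*2.+1 == #|Q|).
  by move=> _; split; rewrite // card_cell_subsquares_le.
have [_] := leqif_sum le_cell.
have -> : \sum_(c : Q * Q) #|cell_subsquares c.1 c.2|.*2.+1 =
    18 * #|subsquares q 3| + #|Q| ^ 2.
  have -> : 18 * #|subsquares q 3| = (9 * #|subsquares q 3|).*2 by lia.
  rewrite -sum_cell_subsquares -muln2 big_distrl -mulnn -card_prod -sum1_card.
  rewrite -big_split; apply: eq_bigr => c _ /=; lia.
rewrite sum_nat_const card_prod mulnn -expnSr => eqC.
split=> [/eqP | cq]; [|apply/eqP]; rewrite eqC.
  by move=> /forallP cq x y; apply/card_cell_subsquares/eqP/(cq (x, y)).
by apply/forallP=> -[x y]; apply/eqP/card_cell_subsquares.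
Qed.

End Quasigroup.

(** * Invariance under isotopy *)

Lemma isotopic_completable (Q P : finType) (q : quasigroup Q)
    (p : quasigroup P) (alpha beta gamma : Q -> P) x y :
  bijective alpha -> bijective beta -> bijective gamma ->
  (forall x y, p (alpha x) (beta y) = gamma (q x y)) ->
  completable q x y <-> completable p (alpha x) (beta y).
Proof.
move=> [alpha' aK a'K] [beta' bK b'K] /bij_inj gI iso.
(* [alpha] moves rows, [beta] columns and [gamma] symbols. The equations of [square3] only compare
   symbols, so they pass forward through [gamma] and back by its injectivity. *)
split=> cxy x' y' nxx' exy.
  have [||x'' [y'' [e1 e2 e3 e4 e5]]] := cxy (alpha' x') (beta' y').
  - by apply: contraNneq nxx' => <-; rewrite a'K.
  - by apply: gI; rewrite -!iso a'K b'K.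
  exists (alpha x''), (beta y''); rewrite -[x']a'K -[y']b'K.
  by split; rewrite !iso; congr gamma.
have [||x'' [y'' [e1 e2 e3 e4 e5]]] := cxy (alpha x') (beta y').
- by rewrite (can_eq aK).
- by rewrite !iso exy.
exists (alpha' x''), (beta' y''); rewrite -[x'']a'K -[y'']b'K in e1 e2 e3 e4 e5.
by split; apply: gI; rewrite -!iso.
Qed.

Lemma loop_isotope_isotopic (Q : finType) (q : quasigroup Q) a b :
  isotopic q (loop_isotope q a b).
Proof.
exists (rtrans q a), (ltrans q b), id.
split; [exact/injF_bij/perm_inj | exact/injF_bij/perm_inj | by exists id |].
by move=> x y; rewrite /= /isotope_mul !permK.
Qed.

Lemma isotopic_card (Q P : finType) (q : quasigroup Q) (p : quasigroup P) :
  isotopic q p -> #|P| = #|Q|.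
Proof. by case=> alpha [_ [_ [/bij_eq_card-> _ _ _]]]. Qed.

(** The isotopism sends the cell [(b, a)] to the neutral cell, since [q b a] is neutral. As [a] and
    [b] vary, the neutral cells of the loop isotopes thus account for every cell of [q]. *)
Lemma completable_loop_isotope (Q : finType) (q : quasigroup Q) a b :
  let l := loop_isotope q a b in
  completable l (neutral l) (neutral l) <-> completable q b a.
Proof.
move=> l; have iso x y : l (rtrans q a x) (ltrans q b y) = id (q x y).
  by rewrite /= /isotope_mul !permK.
have id_bij : bijective (@id Q) by exists id.
have := isotopic_completable b a (injF_bij (@perm_inj _ (rtrans q a)))
  (injF_bij (@perm_inj _ (ltrans q b))) id_bij iso.
by rewrite rtransE ltransE => H; split=> /H.
Qed.

(** * Loops of exponent 3 and subloops of order 3 *)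

Section Loop.
Variables (P : finType) (l : loop P).
Local Notation e := (neutral l).

Lemma exponent3P : exponent3 l <-> completable l e e.
Proof.
split=> [e3 x y nx exy | ce x].
  have {exy} -> : y = l x x.
    by apply: (@qmulI _ l x); rewrite exy neutral_left (e3 x).2.
  have xxx : l (l x x) x = e /\ l x (l x x) = e := e3 x.
  (* Without associativity, this comes from exponent 3 at [l x x]: multiplied on the right by
     [l x x], both sides give [e]. *)
  have x4 : l (l x x) (l x x) = x.
    apply: (@qmulIr _ l (l x x)).
    by rewrite (e3 (l x x)).1 xxx.2.
  (* The square is the table of the cyclic group [e], [x], [l x x]. *)
  exists (l x x), x; split; rewrite ?neutral_left ?neutral_right //.
  exact: xxx.1.
have [-> | nx] := eqVneq x e; first by rewrite !neutral_left.
(* The square through [(e, e)] and [(x, y)] forces [l x x = y] and [l y x = e]. *)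
pose y := ((ltrans l x)^-1 e)%g.
have exy : l x y = e by rewrite ltransKV.
have [|x'' [y'' []]] := ce x y nx; first by rewrite neutral_left.
rewrite !neutral_left !neutral_right => -> xx -> _ yx.
by rewrite xx exy yx.
Qed.

Lemma subloop_subsquare : {in subloops l 3, forall S : {set P},
  (S, S) \in cell_subsquares l e e}.
Proof.
move=> S; rewrite inE => /andP[/andP[eS /forall_inP SS] /eqP S3].
rewrite inE /in_subsquare /= eS !andbT; apply/subsquareP; split=> //=.
apply/eqP; rewrite eqn_leq -{1}S3 subset_leq_card /=; last first.
  apply/subsetP=> _ /imset2P[x y /= xS yS ->].
  by have /forall_inP/(_ y yS)/and3P[] := SS x xS.
rewrite -S3 subset_leq_card //; apply/subsetP=> x xS.
by rewrite -[x](neutral_left l) imset2_f.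
Qed.

(** Products with [e] put the rows and the columns among the symbols; having equal sizes, the three
    sets coincide. *)
Lemma subsquare_subloop S : S \in cell_subsquares l e e ->
  S.1 = S.2 /\ S.1 \in subloops l 3.
Proof.
rewrite inE => /andP[/subsquareP[A3 B3 C3] /andP[eA eB]].
have AC : S.1 = l @2: (S.1, S.2).
  apply/eqP; rewrite eqEcard A3 C3 andbT; apply/subsetP=> x xA.
  by rewrite -[x](neutral_right l) imset2_f.
have BC : S.2 = l @2: (S.1, S.2).
  apply/eqP; rewrite eqEcard B3 C3 andbT; apply/subsetP=> x xB.
  by rewrite -[x](neutral_left l) imset2_f.
have AB : S.1 = S.2 := etrans AC (esym BC).
rewrite -AB in AC; set A := S.1 in A3 AC eA *; split=> //.
rewrite inE A3 eqxx andbT /is_subloop eA; apply/forall_inP=> x xA.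
have mulA z t : z \in A -> t \in A -> l z t \in A.
  by move=> zA tA; rewrite AC imset2_f.
(* A permutation mapping a finite set into itself maps it onto itself, so closure under products
   gives closure under divisions. *)
have divA (s : {perm P}) y : (forall z, z \in A -> s z \in A) -> y \in A ->
    (s^-1)%g y \in A.
  move=> sA yA; have sAA : s @: A = A.
    apply/eqP; rewrite eqEcard card_imset ?leqnn ?andbT; last exact: perm_inj.
    by apply/subsetP=> _ /imsetP[z zA ->]; apply: sA.
  by move: yA; rewrite -{1}sAA => /imsetP[z zA ->]; rewrite permK.
apply/forall_inP=> y yA; rewrite mulA // !divA // => z zA.
  by rewrite rtransE mulA.
by rewrite ltransE mulA.
Qed.

Lemma card_subloops3 : #|subloops l 3| = #|cell_subsquares l e e|.
Proof.
rewrite -(card_imset _ (_ : injective (fun A : {set P} => (A, A)))); last first.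
  by move=> A B [].
apply: eq_card => S; apply/imsetP/idP => [[A /subloop_subsquare AS ->] // | SS].
have [E A] := subsquare_subloop SS.
by exists S.1 => //; rewrite {2}E; case: (S).
Qed.

Lemma card_subloops : #|subloops l 3|.*2.+1 = #|P| <-> exponent3 l.
Proof.
by rewrite card_subloops3; split=> [/card_cell_subsquares/exponent3P |
  /exponent3P/card_cell_subsquares].
Qed.

End Loop.

(** * Regular permutations of order 3 and translations *)

Lemma regular3P (T : finType) (s : {perm T}) :
  regular3 s <-> forall z, s z != z /\ s (s (s z)) = z.
Proof.
split=> [s3 z | sz _ /imsetP[z _ ->]].
  have c3 : #|porbit s z| = 3 by apply: s3; apply: imset_f.
  split; last by have := iter_porbit s z; rewrite c3.
  have := uniq_traject_porbit s z.
  by rewrite c3 /= !inE negb_or eq_sym => /andP[/andP[]].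
have [nz szzz] := sz z.
have -> : porbit s z = [set z; s z; s (s z)].
  apply/setP=> t; rewrite !inE; apply/porbitP/idP.
    case=> i ->; elim: i => [|i]; first by rewrite expg0 perm1 eqxx.
    rewrite expgSr permM -!orbA.
    by case/or3P=> /eqP->; rewrite ?szzz !eqxx ?orbT.
  rewrite -orbA => /or3P[] /eqP->.
  - by exists 0; rewrite expg0 perm1.
  - by exists 1; rewrite expg1.
  - by exists 2; rewrite expgS expg1 permM.
rewrite -setUA !cardsU1 cards1 !inE negb_or [z == _]eq_sym nz.
rewrite [s z == _]eq_sym (sz (s z)).1.
suff -> : z != s (s z) by [].
by apply: contraNneq nz => /(congr1 s); rewrite szzz => ->.
Qed.

Lemma regular3J (T : finType) (s c : {perm T}) :
  regular3 s -> regular3 (s ^ c)%g.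
Proof.
move=> /regular3P s3; apply/regular3P=> z; rewrite -[z](permKV c).
set w := (c^-1)%g z; have [nw sw] := s3 w.
by rewrite !permJ sw (inj_eq perm_inj).
Qed.

Section Translations.
Variables (Q : finType) (q : quasigroup Q).

Lemma ltransVE x y z : q x y = z -> ((ltrans q x)^-1 z)%g = y.
Proof. by move=> <-; rewrite -ltransE permK. Qed.

Lemma rtransVE x y z : q y x = z -> ((rtrans q x)^-1 z)%g = y.
Proof. by move=> <-; rewrite -rtransE permK. Qed.

Lemma completable_regular3_ltrans x y : (forall z, completable q x z) ->
  x != y -> regular3 (ltrans q y * (ltrans q x)^-1)%g.
Proof.
move=> cx nxy; apply/regular3P=> z; rewrite !permM !ltransE.
set w := ((ltrans q x)^-1 (q y z))%g.
have exw : q x w = q y z by rewrite ltransKV.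
have [||x'' [y'' [e1 e2 _ _ _]]] := cx w y z; [by rewrite eq_sym | by [] |].
(* The cycle is [z], [w], [y''], made of the three columns of the square. *)
rewrite (ltransVE e1) (ltransVE (esym e2)); split=> //.
by apply: contraNneq nxy => e; rewrite e in exw; rewrite (qmulIr exw).
Qed.

Lemma completable_regular3_rtrans x y : (forall z, completable q z x) ->
  x != y -> regular3 (rtrans q y * (rtrans q x)^-1)%g.
Proof.
move=> cx nxy; apply/regular3P=> z; rewrite !permM !rtransE.
set w := ((rtrans q x)^-1 (q z y))%g.
have ewx : q w x = q z y by rewrite rtransKV.
have nzw : z != w.
  by apply: contraNneq nxy => e; rewrite -e in ewx; rewrite (qmulI ewx).
have [|x'' [y'' [_ _ e3 e4 _]]] := cx w z y nzw; first by [].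
(* Here the cycle is [z], [w], [x''], made of the three rows. *)
by rewrite (rtransVE e3) (rtransVE (esym e4)) eq_sym.
Qed.

(** The translation is [(ltrans q b)^-1 * ltrans q c] in action order; the conjugate form exposes a
    permutation as in condition (5), with the same cycle lengths. *)
Lemma ltrans_loop_isotope a b x : let c := ((rtrans q a)^-1 x)%g in
  ltrans (loop_isotope q a b) x =
  ((ltrans q c * (ltrans q b)^-1) ^ ltrans q b)%g.
Proof.
move=> c; rewrite conjgE mulgKV; apply/permP=> z.
by rewrite permM !ltransE.
Qed.

Lemma rtrans_loop_isotope a b x : let c := ((ltrans q b)^-1 x)%g in
  rtrans (loop_isotope q a b) x =
  ((rtrans q c * (rtrans q a)^-1) ^ rtrans q a)%g.
Proof.
move=> c; rewrite conjgE mulgKV; apply/permP=> z.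
by rewrite permM !rtransE.
Qed.

End Translations.

(** Each translation by [x] has trivial cube; evaluating the cubes at the neutral element gives the
    two identities of exponent 3. *)
Lemma regular3_exponent3 (P : finType) (l : loop P) :
  (forall x, x <> neutral l -> regular3 (ltrans l x) /\ regular3 (rtrans l x)) ->
  exponent3 l.
Proof.
move=> l3 x; have [-> | /eqP/l3[]] := eqVneq x (neutral l).
  by rewrite !neutral_left.
move=> /regular3P/(_ (neutral l))[_ Lx] /regular3P/(_ (neutral l))[_ Rx].
by move: Lx Rx; rewrite !ltransE !rtransE neutral_left neutral_right.
Qed.

(** * Rational forms of the counts, and the equivalence *)

Lemma natr_eq_half (k n : nat) :
  (k%:R = (n%:R - 1) / 2%:R :> rat)%R <-> k.*2.+1 = n.
Proof.
split=> [e | <-]; last by rewrite -muln2 -addn1 natrD natrM; field.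
by apply/eqP; rewrite -(eqr_nat rat) -muln2 -addn1 natrD natrM e; apply/eqP; field.
Qed.

Lemma natr_eq_eighteenth (k n : nat) :
  (k%:R = n%:R ^+ 2 * (n%:R - 1) / 18%:R :> rat)%R <-> 18 * k + n ^ 2 = n ^ 3.
Proof.
split=> [e | /eqP].
  apply/eqP; rewrite -(eqr_nat rat) natrD natrM !natrX e; apply/eqP; lra.
by rewrite -(eqr_nat rat) natrD natrM !natrX => /eqP e; lra.
Qed.

Theorem theorem1 (Q : finType) (q : quasigroup Q) :
  let n : rat := (#|Q|%:R)%R in
  [<-> (* (1) *)
       (#|subsquares q 3|%:R = n ^+ 2 * (n - 1) / 18%:R)%R;
       (* (2) *)
       forall x y x' y' : Q, (x, y) <> (x', y') -> q x y = q x' y' ->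
         exists S, [/\ S \in subsquares q 3,
                       in_subsquare x y S & in_subsquare x' y' S];
       (* (3) *)
       forall x y : Q,
         (#|[set S in subsquares q 3 | in_subsquare x y S]|%:R
            = (n - 1) / 2%:R)%R;
       (* (4) *)
       forall (P : finType) (l : loop P), isotopic q l -> exponent3 l;
       (* (5): in {perm Q}, (s * t) z = t (s z) *)
       forall x y : Q, x <> y ->
         regular3 (ltrans q y * (ltrans q x)^-1)%g /\
         regular3 (rtrans q y * (rtrans q x)^-1)%g;
       (* (6) *)
       forall a b x : Q, x <> neutral (loop_isotope q a b) ->
         regular3 (ltrans (loop_isotope q a b) x) /\
         regular3 (rtrans (loop_isotope q a b) x);
       (* (7) *)
       forall (P : finType) (l : loop P), isotopic q l ->
         (#|subloops l 3|%:R = (n - 1) / 2%:R)%R].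
Proof.
move=> n.
have c1 : (#|subsquares q 3|%:R = n ^+ 2 * (n - 1) / 18%:R)%R <->
    forall x y, completable q x y.
  by split=> [/natr_eq_eighteenth/card_subsquares |
    /card_subsquares/natr_eq_eighteenth].
have c3 x y : (#|cell_subsquares q x y|%:R = (n - 1) / 2%:R)%R <->
    completable q x y.
  by split=> [/natr_eq_half/card_cell_subsquares |
    /card_cell_subsquares/natr_eq_half].
have c7 (P : finType) (l : loop P) : isotopic q l ->
    (#|subloops l 3|%:R = (n - 1) / 2%:R)%R <-> exponent3 l.
  move=> iso; rewrite /n -(isotopic_card iso).
  by split=> [/natr_eq_half/card_subloops | /card_subloops/natr_eq_half].
have loop_completable : (forall a b, exponent3 (loop_isotope q a b)) ->
    forall x y, completable q x y.
  by move=> e3 x y; apply/completable_loop_isotope/exponent3P/e3.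
have completable_loop : (forall x y, completable q x y) ->
    forall (P : finType) (l : loop P), isotopic q l -> exponent3 l.
  move=> cq P l [alpha [beta [gamma [aB bB gB iso]]]]; apply/exponent3P.
  have [[alpha' _ a'K] [beta' _ b'K]] := (aB, bB).
  (* The neutral cell of [l] is the image of some cell of [q]. *)
  rewrite -{1}[neutral l]a'K -[neutral l]b'K.
  by apply/(isotopic_completable _ _ aB bB gB iso).
(* The implications form one cycle, from (1) through (7) and back to (1). *)
tfae.
- by move=> /c1 cq x y; apply/completableP.
- by move=> cq x y; apply/c3/completableP/cq.
- move=> sq; apply: completable_loop => x y; apply/c3; exact: sq.
- move=> e3 x y /eqP nxy.
  have cq : forall x y, completable q x y.
    by apply: loop_completable => a b; apply/e3/loop_isotope_isotopic.
  split; first exact: completable_regular3_ltrans (cq x) nxy.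
  exact: completable_regular3_rtrans (cq^~ x) nxy.
- move=> r3 a b x nx; rewrite ltrans_loop_isotope rtrans_loop_isotope.
  split; apply: regular3J.
    (* If this row were [b], then [x] would be the neutral element [q b a]. *)
    have [|//] := r3 b ((rtrans q a)^-1 x)%g.
    by move=> e; apply: nx; rewrite /= {1}e rtransKV.
  have [|//] := r3 a ((ltrans q b)^-1 x)%g.
  by move=> e; apply: nx; rewrite /= {1}e ltransKV.
(* The loop isotopes carried by [Q] make all cells completable, which then reaches isotopic loops on
   any carrier. *)
- move=> r3 P l iso; apply/c7 => //; apply: completable_loop iso.
  by apply: loop_completable => a b; apply/regular3_exponent3/r3.
- move=> s3; apply/c1/loop_completable => a b.
  by apply/c7; [|apply: s3]; apply: loop_isotope_isotopic.
Qed.
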